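(* Let $q$ be a prime power and $n,k,\delta$ positive integers with $n\geq2k+\delta$ and $k\geq 2\delta$. Then $$\bar A_q(n,2\delta,k)\geq q^{(n-k)(k-\delta+1)}\frac{1-q^{-\lfloor k/\delta\rfloor\delta^2}}{1-q^{-\delta^2}}+q^{(n-k-\delta)(k-\delta+1)}+A^R_q(k\times (n-k), \delta, [0,k-\delta]).$$
   Context: $\mathcal G_q(n,k)$ is the set of $k$-dimensional subspaces of $\mathbb F_q^n$, with subspace distance $d_S(\mathcal U,\mathcal V)=\dim\mathcal U+\dim\mathcal V-2\dim(\mathcal U\cap\mathcal V)$; an $(n,d,k)_q$-CDC is a subset of $\mathcal G_q(n,k)$ with pairwise subspace distance at least $d$. An MRD$[k\times(n-k),\delta]_q$ code is an $\mathbb F_q$-linear subspace of $\mathbb F_q^{k\times(n-k)}$ of dimension $\max\{k,n-k\}(\min\{k,n-k\}-\delta+1)$ whose nonzero elements have rank at least $\delta$; a lifted MRD code is $\{\mathrm{rowspace}(\boldsymbol I_k\mid\boldsymbol A):\boldsymbol A\in\mathcal D\}$ for such $\mathcal D$. $\bar A_q(n,2\delta,k)$ is the maximum size of an $(n,2\delta,k)_q$-CDC containing a lifted MRD code as a subset. $A^R_q(k\times(n-k),\delta,K)$ is the maximum size of a set of matrices in $\mathbb F_q^{k\times(n-k)}$, each of rank in $K$, with pairwise rank distance $\mathrm{rank}(\boldsymbol D_1-\boldsymbol D_2)\ge\delta$; $[a,b]$ is the set of integers $x$ with $a\le x\le b$. *)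

(* Defs.v *)
From HB Require Import structures.
From mathcomp Require Import all_boot all_order all_algebra.

Set Implicit Arguments.
Unset Strict Implicit.
Unset Printing Implicit Defensive.

Import GRing.Theory.
Local Open Scope ring_scope.

(* Subspaces of a finite-dimensional space over a finite field form a finite
   type, so that a code can be a term of type {set {vspace 'rV[F]_n}} and
   maximum code sizes are \max over a finite type. *)
Section FiniteVspace.
Import VectorInternalTheory.
Variables (F : finFieldType) (vT : vectType F).

HB.instance Definition _ := [Countable of {vspace vT} by <:].
HB.instance Definition _ := [Finite of {vspace vT} by <:].

End FiniteVspace.

Section Codes.
Variable F : finFieldType.

(* The truncated subtraction is exact: \dim (U :&: V) is at most both \dim U
   and \dim V. *)
Definition subspace_dist (n : nat) (U V : {vspace 'rV[F]_n}) : nat :=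
  (\dim U + \dim V - 2 * \dim (U :&: V))%N.

Definition is_CDC (n d k : nat) (C : {set {vspace 'rV[F]_n}}) : bool :=
  [forall U in C, \dim U == k] &&
  [forall U in C, forall V in C, (U != V) ==> (d <= subspace_dist U V)%N].

Definition rank_dist m p (A B : 'M[F]_(m, p)) : nat := \rank (A - B).

(* Meaningful for 1 <= delta <= minn m p. *)
Definition is_MRD (m p delta : nat) (D : {vspace 'M[F]_(m, p)}) : bool :=
  (\dim D == maxn m p * (minn m p - delta + 1))%N &&
  [forall A in D, (A != 0) ==> (delta <= \rank A)%N].

Definition rowspace m n (M : 'M[F]_(m, n)) : {vspace 'rV[F]_n} :=
  <<[seq row i M | i : 'I_m]>>%VS.

(* For k <= n, conform_mx is the cast along k + (n - k) = n. *)
Definition lift_mx n k (A : 'M[F]_(k, n - k)) : {vspace 'rV[F]_n} :=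
  rowspace (conform_mx (0 : 'M[F]_(k, n)) (row_mx 1%:M A)).

Definition lifted_code n k (D : {vspace 'M[F]_(k, n - k)}) :
    {set {vspace 'rV[F]_n}} :=
  [set lift_mx A | A in D].

Definition contains_lifted_MRD (n k delta : nat)
    (C : {set {vspace 'rV[F]_n}}) : bool :=
  [exists D : {vspace 'M[F]_(k, n - k)},
     is_MRD delta D && (lifted_code D \subset C)].

(* The quantity usually written \bar A_q(n, 2 delta, k): the MRD distance
   delta is half of the subspace distance of the code. *)
Definition Abar (n delta k : nat) : nat :=
  \max_(C : {set {vspace 'rV[F]_n}} |
        is_CDC (2 * delta) k C && contains_lifted_MRD k delta C) #|C|.

Definition is_restricted_rank_code (m p delta : nat) (K : pred nat)
    (D : {set 'M[F]_(m, p)}) : bool :=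
  [forall A in D, K (\rank A)] &&
  [forall A in D, forall B in D, (A != B) ==> (delta <= rank_dist A B)%N].

Definition AR (m p delta : nat) (K : pred nat) : nat :=
  \max_(D : {set 'M[F]_(m, p)} | is_restricted_rank_code delta K D) #|D|.

End Codes.

Definition nat_interval (a b : nat) : pred nat := fun x => (a <= x <= b)%N.

(* Main.v *)
(** The code is a union of layers of subspaces in reduced echelon form.  For
  z <= k, put the pivots in the columns [0, z) and [z + delta, k + delta), and
  let the other n - k columns carry a matrix A.  If A vanishes in its first
  delta columns from row z on, the echelon shape is respected, and two layers
  whose gaps [z, z + delta) are disjoint share k - delta pivots, so that their
  members meet in dimension at most k - delta.  Inside a layer the subspace
  distance is twice the rank distance.  The gaps at z = k - i delta for
  i < k / delta (z = k being the lifted MRD code) are filled with the matrices of a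
  linear MRD code having the required i delta x delta block of zeros: these
  are i delta^2 linear conditions.  The gap at z = 0 is filled with a shorter
  MRD code.  Finally the rowspaces of (M | I), with M of rank at most
  k - delta, meet all these subspaces in dimension at most rank M, because the
  first n - k columns contain all the pivots of the layers.  Linear MRD codes
  are Gabidulin codes: the matrix of a linearized polynomial of q-degree at
  most m - delta over a field extension has rank at least delta, by
  counting roots. *)

From HB Require Import structures.
Require Import Defs.
From mathcomp Require Import all_boot all_order all_algebra.
From mathcomp Require Import all_fingroup all_solvable all_field zify.

Set Implicit Arguments.
Unset Strict Implicit.
Unset Printing Implicit Defensive.

Import Order.TTheory GRing.Theory Num.Theory.
Local Open Scope ring_scope.

(** * Finite field extensions of every degree *)

Lemma natr_card_finField (F : finFieldType) : #|F|%:R = 0 :> F.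
Proof.
by have := expg_cardG (in_setT (1 : F)); rewrite FinRing.zmodXgE cardsT.
Qed.

(** Packing the power map as a Galois automorphism gives its F-linearity and makes its fixed points
    a subfield. *)
Lemma frobenius_gal (F : finFieldType) (L : splittingFieldType F) (i : nat) :
  {a : gal_of {:L} | forall x, a x = x ^+ (#|F| ^ i)}.
Proof.
have [a _ Da] := finField_galois_generator (sub1v {:L}).
rewrite /= dimv1 expn1 in Da.
exists (a ^+ i)%g; elim: i => [|i IHi] x; first by rewrite gal_id.
by rewrite expgSr galM ?memvf // IHi Da ?memvf // -exprM -expnSr.
Qed.

(** Take a splitting field of [X^m - X] with m = |F|^N. The roots are distinct and are the fixed
    points of an automorphism, hence a subfield. As they generate L, they are all of L, and |L| =
    m. *)
Lemma finField_extension (F : finFieldType) (N : nat) : (0 < N)%N ->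
  {L : splittingFieldType F | \dim {:L} = N}.
Proof.
move=> N_gt0; pose m := (#|F| ^ N)%N.
have m_gt1 : (1 < m)%N by rewrite (ltn_exp2l 0) // finNzRing_gt1.
pose P (R : nzRingType) : {poly R} := 'X^m - 'X.
have szP (R : nzRingType) : size (P R) = m.+1.
  by rewrite /P size_polyDl size_polyXn // size_polyN size_polyX.
have /FinSplittingFieldFor[L splitLP] : P F != 0 by rewrite -size_poly_eq0 szP.
exists L; rewrite [map_poly _ _]rmorphB rmorphXn /= map_polyX -/(P L) in splitLP.
have [zs DP defL] := splitLP.
(* The derivative of [P L] is then -1, so its roots are simple. *)
have m0 : m%:R = 0 :> L.
  rewrite natrX -(rmorph_nat (in_alg L)) natr_card_finField rmorph0 expr0n.
  by rewrite gtn_eqF.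
have Uzs : uniq zs.
  rewrite -separable_prod_XsubC -(eqp_separable DP) separable_poly.unlock.
  rewrite /P derivB derivXn derivX -mulr_natr -polyC_natr m0 mulr0 sub0r.
  by rewrite -[- 1]scaleN1r coprimepZr ?oppr_eq0 ?oner_eq0 ?coprimep1.
have [a Da] := frobenius_gal L N.
have in_zs z : (z \in zs) = (z \in fixedSpace a).
  rewrite -root_prod_XsubC -(eqp_root DP) (sameP fixedSpaceP eqP) /root !hornerE.
  by rewrite subr_eq0 Da.
have fixL : fixedSpace a = {:L}%VS.
  apply/eqP; rewrite eqEsubv subvf -{1}defL -[fixedSpace a]subfield_closed agenvS //.
  by rewrite subv_add sub1v; apply/span_subvP=> z; rewrite in_zs.
have cardL : #|FinFieldExtType L| = m.
  have /eq_card-> : FinFieldExtType L =i zs by move=> z; rewrite in_zs fixL memvf.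
  apply: succn_inj; rewrite -(szP L) (eqp_size DP) size_prod_XsubC.
  by congr _.+1; apply/card_uniqP.
apply/eqP; rewrite -(@eqn_exp2l #|F|) ?finNzRing_gt1 // -/m -cardL.
by rewrite -(card_vspace (fullv : {vspace finvect_type L})) card_vspacef.
Qed.

(** * Gabidulin codes and the existence of linear MRD codes *)

Section Gabidulin.
Variables (F : finFieldType) (L : splittingFieldType F) (m d : nat).
Let q := #|F|.
Let basis := vbasis {:L}.
Implicit Types f : {ffun 'I_d -> L}.

Definition linearized_eval f (x : L) : L := \sum_(i < d) f i * x ^+ (q ^ i).

Lemma linearized_eval_is_linear f : linear (linearized_eval f).
Proof.
move=> a u v; rewrite /linearized_eval scaler_sumr -big_split.
apply: eq_bigr => i _ /=; have [b Db] := frobenius_gal L i.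
by rewrite -!Db linearP mulrDr scalerAr.
Qed.

HB.instance Definition _ f :=
  GRing.isLinear.Build F L L _ (linearized_eval f) (linearized_eval_is_linear f).

Definition linearized_poly f : {poly L} := \sum_(i < d) f i *: 'X^(q ^ i).

Lemma horner_linearized_poly f x : (linearized_poly f).[x] = linearized_eval f x.
Proof. by rewrite horner_sum; apply: eq_bigr => i _; rewrite !hornerE. Qed.

(** The exponents q^i are pairwise distinct because q > 1, so no two coefficients merge. *)
Lemma linearized_poly_eq0 f : (linearized_poly f == 0) = (f == 0).
Proof.
apply/eqP/eqP => [f0 | ->]; last first.
  by rewrite /linearized_poly big1 // => i _; rewrite ffunE scale0r.
apply/ffunP => i; rewrite ffunE -(coef0 _ (q ^ i)) -f0 coef_sum (bigD1 i) //=.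
rewrite coefZ coefXn eqxx mulr1 big1 ?addr0 // => j neji.
by rewrite coefZ coefXn eqn_exp2l ?finNzRing_gt1 // val_eqE eq_sym (negPf neji) mulr0.
Qed.

Lemma size_linearized_poly f : (size (linearized_poly f) <= (q ^ d.-1).+1)%N.
Proof.
apply: (leq_trans (size_sum _ _ _)); apply/bigmax_leqP => i _.
apply: (leq_trans (size_scale_leq _ _)); rewrite size_polyXn ltnS.
by rewrite leq_exp2l ?finNzRing_gt1 // -ltnS (leq_trans (ltn_ord i)) ?leqSpred.
Qed.

(** Only the first [m] basis vectors are evaluated, which allows fewer rows than columns. *)
Definition gabidulin_mx f : 'M[F]_(m, \dim {:L}) :=
  \matrix_(r, c) coord basis c (linearized_eval f basis`_r).

Lemma gabidulin_mx_is_linear : linear gabidulin_mx.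
Proof.
move=> a f g; apply/matrixP => r c; rewrite !mxE -linearP /=; congr (coord _ _ _).
rewrite /linearized_eval scaler_sumr -big_split; apply: eq_bigr => i _ /=.
by rewrite !ffunE mulrDl scalerAl.
Qed.

HB.instance Definition _ :=
  GRing.isLinear.Build F {ffun 'I_d -> L} _ _ gabidulin_mx gabidulin_mx_is_linear.

Hypothesis le_m_dim : (m <= \dim {:L})%N.

(** Each vector of the left kernel of the matrix gives a root of the linearized polynomial, and
    distinct vectors give distinct roots. So q^(m - rank) is at most the degree bound q^(d - 1). *)
Lemma rank_gabidulin_mx f : f != 0 -> (m < d + \rank (gabidulin_mx f))%N.
Proof.
move=> f_n0; set A := gabidulin_mx f; pose B := row_base (kermx A).
pose comb (c : 'rV[F]_m) : L := \sum_(r < m) c 0 r *: basis`_r.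
have coord_comb c r : coord basis (widen_ord le_m_dim r) (comb c) = c 0 r.
  rewrite linear_sum (bigD1 r) //= big1 => [|r' ne_r'r]; rewrite linearZ /=;
    rewrite -[basis`_ _]/(basis`_(widen_ord le_m_dim _)) coord_free ?(basis_free (vbasisP _)) //.
    by rewrite eqxx mulr1 addr0.
  by rewrite -val_eqE /= val_eqE (negPf ne_r'r) mulr0.
have comb_inj : injective comb.
  by move=> c c' eq_cc'; apply/rowP => r; rewrite -!coord_comb eq_cc'.
have combB_root (x : 'rV_(\rank (kermx A))) : root (linearized_poly f) (comb (x *m B)).
  rewrite /root horner_linearized_poly linear_sum /=; apply/eqP.
  rewrite [LHS](coord_vbasis (memvf _)); apply: big1 => j _.
  have /matrixP/(_ 0 j) : x *m B *m A = 0.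
    by apply/sub_kermxP; rewrite -(eq_row_base (kermx A)) submxMl.
  rewrite !mxE => xBA0; rewrite -[RHS](scale0r (basis`_j)) -[in RHS]xBA0.
  congr (_ *: _); rewrite linear_sum; apply: eq_bigr => r _.
  by rewrite !linearZ /= [gabidulin_mx f _ _]mxE.
have nz : linearized_poly f != 0 by rewrite linearized_poly_eq0.
have := @max_poly_roots _ _ [seq comb (x *m B) | x : 'rV[F]_(\rank (kermx A))] nz.
rewrite size_map -cardE card_mx mul1n => /(_ _ _)/leq_trans/(_ (size_linearized_poly f)).
rewrite ltnS leq_exp2l ?finNzRing_gt1 // => bound.
have {bound} : (m - \rank A <= d.-1)%N.
  rewrite -mxrank_ker; apply: bound; first by apply/allP => _ /mapP[x _ ->].
  rewrite map_inj_uniq ?enum_uniq // => x y /comb_inj.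
  by apply: (row_free_inj (row_base_free _)).
(* Makes [d.-1] an exact predecessor: a nonzero [f] has at least one coefficient. *)
have d_gt0 : (0 < d)%N.
  by case: (posnP d) f_n0 => // d0 /eqP[]; apply/ffunP => i; have := ltn_ord i; rewrite {2}d0.
by lia.
Qed.

End Gabidulin.

(** With L of degree [p] and m - delta + 1 coefficients, the rank exceeds m - (m - delta + 1) =
    delta - 1. *)
Lemma exists_MRD (F : finFieldType) (m p delta : nat) :
  (0 < delta <= m)%N -> (m <= p)%N -> {D : {vspace 'M[F]_(m, p)} | is_MRD delta D}.
Proof.
move=> /andP[delta_gt0 le_dm] le_mp.
have p_gt0 : (0 < p)%N by apply: leq_trans le_mp; apply: leq_trans le_dm.
have [L dimL] := finField_extension F p_gt0; subst p.
pose G := linfun (@gabidulin_mx F L m (m - delta + 1)).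
have rankG (f : {ffun 'I_(m - delta + 1) -> L}) :
    f != 0 -> (delta <= \rank (gabidulin_mx m f))%N.
  by move=> f_n0; have := rank_gabidulin_mx le_mp f_n0; lia.
exists (limg G); rewrite /is_MRD (maxn_idPr le_mp) (minn_idPl le_mp).
apply/andP; split.
  (* Nonzero coefficient vectors have images of positive rank, so the encoding is injective. *)
  rewrite limg_dim_eq ?dimvf; last first.
    apply/eqP; rewrite -subv0; apply/subvP => f; rewrite memv_cap memv_ker memv0.
    rewrite lfunE /= => /andP[_ Gf0]; apply: contraTT delta_gt0 => /rankG.
    by rewrite (eqP Gf0) mxrank0; lia.
  by rewrite mulnC /dim /= card_ord.
apply/forall_inP => A /memv_imgP[f _ ->]; rewrite lfunE /=; apply/implyP => Gf_n0.
by apply: rankG; apply: contraNneq Gf_n0 => ->; rewrite linear0.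
Qed.

(** The tool behind every bound on an intersection of codewords, where f is a projection onto
    selected columns. *)
Lemma dim_le_inj_on (K : fieldType) (vT wT : vectType K) (f : 'Hom(vT, wT))
    (X : {vspace vT}) (Y : {vspace wT}) :
    {in X, forall v, f v = 0 -> v = 0} -> {in X, forall v, f v \in Y} ->
  (\dim X <= \dim Y)%N.
Proof.
move=> f_inj fXY; rewrite -(@limg_dim_eq _ _ _ f X).
  by apply/dimvS/subvP => _ /memv_imgP[v Xv ->]; apply: fXY.
apply/eqP; rewrite -subv0; apply/subvP => v; rewrite memv_cap memv_ker memv0.
by case/andP=> Xv /eqP fv0; apply/eqP/f_inj.
Qed.

(** * Row spaces and their dimension *)

Section Rowspace.
Variable F : finFieldType.

Lemma rowspaceP m n (M : 'M[F]_(m, n)) (w : 'rV_n) :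
  reflect (exists x, w = x *m M) (w \in rowspace M).
Proof.
apply: (iffP idP) => [|[x ->]]; last first.
  rewrite mulmx_sum_row; apply: memv_suml => i _; apply/memvZ/memv_span.
  by apply/imageP; exists i.
suffices /subvP sub_img : (rowspace M <= limg (linfun (mulmxr M)))%VS.
  by move=> /sub_img/memv_imgP[x _ ->]; exists x; rewrite lfunE.
apply/span_subvP => _ /imageP[i _ ->]; apply/memv_imgP.
by exists (delta_mx 0 i); rewrite ?memvf // lfunE /= rowE.
Qed.

Lemma dim_rowspace m n (M : 'M[F]_(m, n)) : \dim (rowspace M) = \rank M.
Proof.
apply/eqP; rewrite eqn_leq; apply/andP; split.
  have /eqP-> : rowspace M == rowspace (row_base M).
    rewrite eqEsubv; apply/andP; split; apply/subvP => _ /rowspaceP[x ->].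
      have /submxP[y ->] : (x *m M <= row_base M)%MS by rewrite eq_row_base submxMl.
      by apply/rowspaceP; exists y.
    have /submxP[y ->] : (x *m row_base M <= M)%MS.
      by rewrite -(eq_row_base M) submxMl.
    by apply/rowspaceP; exists y.
  by rewrite (leq_trans (dim_span _)) // size_image card_ord.
have -> : \rank M = \dim {:'rV[F]_(\rank M)} by rewrite dimvf /dim /= mul1n.
apply: (@dim_le_inj_on _ _ _ (linfun (mulmxr (row_base M)))) => x _; rewrite lfunE /=.
  by rewrite -[RHS](mul0mx _ (row_base M)); apply/row_free_inj/row_base_free.
by have /submxP[y ->] : (x *m row_base M <= M)%MS;
  [rewrite -(eq_row_base M) submxMl | apply/rowspaceP; exists y].
Qed.

End Rowspace.

(** * Codewords with permuted columns, and unions of layers *)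

Section Codewords.
Variables (F : finFieldType) (k p n : nat).
Implicit Types (g : 'I_n -> 'I_(k + p)) (A B : 'M[F]_(k, p)).

(** [g] sends an ambient column to the column of (I | A) placed there, so that one definition covers
    all layers. *)
Definition codeword g A : {vspace 'rV[F]_n} := rowspace (colsub g (row_mx 1%:M A)).

Lemma codewordP g A (w : 'rV[F]_n) :
  reflect (exists x : 'rV[F]_k, forall j, w 0 j = row_mx x (x *m A) 0 (g j))
    (w \in codeword g A).
Proof.
have eqw x : x *m colsub g (row_mx 1%:M A) = colsub g (row_mx x (x *m A)).
  by rewrite mulmx_colsub mul_mx_row mulmx1.
apply: (iffP (rowspaceP _ _)) => [[x ->] | [x wE]]; exists x.
  by move=> j; rewrite eqw mxE.
by rewrite eqw; apply/rowP => j; rewrite wE [RHS]mxE.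
Qed.

Definition colproj m (s : 'I_m -> 'I_n) : 'Hom('rV[F]_n, 'rV[F]_m) :=
  linfun (mulmxr (colsub s 1%:M)).

Lemma colprojE m (s : 'I_m -> 'I_n) (w : 'rV[F]_n) i : colproj s w 0 i = w 0 (s i).
Proof. by rewrite lfunE /= mulmx_colsub mulmx1 mxE. Qed.

Variables (g : 'I_n -> 'I_(k + p)) (h : 'I_(k + p) -> 'I_n).
Hypothesis hK : cancel h g.

(** A common vector has the same pivot coordinates x in both spaces, and x A = x B. Projecting onto
    the pivots thus embeds the intersection in the left kernel of A - B. *)
Lemma dim_cap_codeword A B :
  (\dim (codeword g A :&: codeword g B) <= k - \rank (A - B)%R)%N.
Proof.
rewrite -mxrank_ker -dim_rowspace.
apply: (@dim_le_inj_on _ _ _ (colproj (h \o lshift p))) => w;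
  rewrite memv_cap => /andP[/codewordP[x wA] /codewordP[y wB]].
  move=> /rowP w0; suffices x0 : x = 0.
    by apply/rowP => j; rewrite wA x0 mul0mx row_mx0 mxE [RHS]mxE.
  by apply/rowP => i; have := w0 i; rewrite colprojE wA /= hK row_mxEl.
have projw z C : (forall j, w 0 j = row_mx z (z *m C) 0 (g j)) ->
    colproj (h \o lshift p) w = z.
  by move=> wC; apply/rowP => i; rewrite colprojE wC /= hK row_mxEl.
have xy : x = y by rewrite -(projw _ _ wA) (projw _ _ wB).
rewrite (projw _ _ wA); apply/rowspaceP/submxP/sub_kermxP.
rewrite mulmxBr; apply/eqP; rewrite subr_eq0 {2}xy; apply/eqP/rowP => c.
by have := wA (h (rshift k c)); rewrite wB !hK !row_mxEr.
Qed.

Lemma dim_codeword A : \dim (codeword g A) = k.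
Proof.
apply/eqP; rewrite eqn_leq; apply/andP; split.
  by rewrite dim_rowspace rank_leq_row.
have {1}<- : \dim {:'rV[F]_k} = k by rewrite dimvf /dim /= mul1n.
apply: (@dim_le_inj_on _ _ _ (linfun (mulmxr (colsub g (row_mx 1%:M A))))) => x _.
  rewrite lfunE /= mulmx_colsub mul_mx_row mulmx1 => /rowP w0.
  by apply/rowP => i; have := w0 (h (lshift p i)); rewrite [LHS]mxE hK row_mxEl => ->; rewrite !mxE.
by rewrite lfunE; apply/rowspaceP; exists x.
Qed.

End Codewords.

(** Spaces of dimension k that meet in dimension at most k - delta are at subspace distance at least
    2 delta. As delta > 0 they are also different, which makes the sizes add up. *)
Lemma code_union (F : finFieldType) (k p n delta : nat) (I : finType)
    (g : I -> 'I_n -> 'I_(k + p)) (h : I -> 'I_(k + p) -> 'I_n)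
    (D : I -> {set 'M[F]_(k, p)}) :
    (0 < delta <= k)%N -> (forall i, cancel (h i) (g i)) ->
    (forall i, is_restricted_rank_code delta predT (D i)) ->
    (forall i j A B, i != j -> A \in D i -> B \in D j ->
      (\dim (codeword (g i) A :&: codeword (g j) B) <= k - delta)%N) ->
  let C := \bigcup_i [set codeword (g i) A | A in D i] in
  is_CDC (2 * delta) k C /\ #|C| = \sum_i #|D i|.
Proof.
move=> /andP[delta_gt0 le_dk] hK rankD crossD C.
have capD i j A B : A \in D i -> B \in D j -> (i != j) || (A != B) ->
    (\dim (codeword (g i) A :&: codeword (g j) B) <= k - delta)%N.
  move=> DA DB; case: eqVneq => [eqij | neqij] /=; last by move=> _; apply: crossD.
  subst j; move=> neqAB; have /andP[_ /forall_inP/(_ _ DA)/forall_inP/(_ _ DB)] := rankD i.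
  rewrite neqAB /rank_dist /= => le_d.
  by apply: leq_trans (dim_cap_codeword (hK i) A B) _; lia.
have neqD i j A B : A \in D i -> B \in D j -> (i != j) || (A != B) ->
    codeword (g i) A != codeword (g j) B.
  move=> DA DB neq; apply: contraTneq (capD _ _ _ _ DA DB neq) => ->.
  by rewrite capvv (dim_codeword (hK j)); lia.
split.
  apply/andP; split.
    by apply/forall_inP => U /bigcupP[i _ /imsetP[A _ ->]]; rewrite (dim_codeword (hK i)).
  apply/forall_inP => U /bigcupP[i _ /imsetP[A DA ->]].
  apply/forall_inP => V /bigcupP[j _ /imsetP[B DB ->]]; apply/implyP => neqUV.
  have neq : (i != j) || (A != B).
    rewrite -negb_and; apply: contraNN neqUV => /andP[/eqP<- /eqP<-]; exact: eqxx.
  have := capD _ _ _ _ DA DB neq.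
  by rewrite /subspace_dist (dim_codeword (hK i)) (dim_codeword (hK j)); lia.
rewrite -sum1_card partition_disjoint_bigcup => [|i j neqij].
  apply: eq_bigr => i _; rewrite sum1_card card_in_imset // => A B DA DB.
  by apply: contra_eq => neqAB; apply: neqD => //; rewrite neqAB orbT.
rewrite -setI_eq0; apply/eqP/setP => U; rewrite !inE; apply/negP.
move=> /andP[/imsetP[A DA ->] /imsetP[B DB]]; apply/eqP/neqD => //.
by rewrite neqij.
Qed.

(* The default value is junk, taken only where r leaves [0, n). *)
Definition ord_map m n (le_mn : (m <= n)%N) (r : nat -> nat) (i : 'I_m) : 'I_n :=
  insubd (widen_ord le_mn i) (r i).

Lemma val_ord_map m n (le_mn : (m <= n)%N) (r : nat -> nat) (i : 'I_m) :
  (r i < n)%N -> val (ord_map le_mn r i) = r i.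
Proof. by rewrite val_insubd => ->. Qed.

(* Sends the column j of the ambient space to its position in (I | A), for the
   gap [z, z + d). *)
Definition skip_perm (k d z j : nat) : nat :=
  if (j < z)%N then j else if (j < z + d)%N then (k + (j - z))%N
  else if (j < k + d)%N then (j - d)%N else j.

(** The first [d] columns of A land in the gap, so a zero corner of A becomes a zero block there. *)
Definition skip_perm_inv (k d z u : nat) : nat :=
  if (u < z)%N then u else if (u < k)%N then (u + d)%N
  else if (u < k + d)%N then (z + (u - k))%N else u.

(** Puts the identity block last, as in (M | I). Exchanging [k] and [p] gives the inverse. *)
Definition swap_perm (k p j : nat) : nat := if (j < p)%N then (k + j)%N else (j - p)%N.

(** Turns the cast inside [lift_mx] into a choice of columns, the form that [codeword] has. *)
Lemma conform_mx_colsub (R : Type) m n n' (eq_n : n = n') (M0 : 'M[R]_(m, n))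
    (M : 'M[R]_(m, n')) :
  conform_mx M0 M = colsub (cast_ord eq_n) M.
Proof.
by subst n'; rewrite conform_mx_id; apply/matrixP => i j; rewrite mxE cast_ord_id.
Qed.

(** * The layers and their pairwise intersections *)

Section Levels.
Variables (F : finFieldType) (k n delta : nat).
Hypothesis le_kdn : (k + delta <= n)%N.

Let eq_n : n = (k + (n - k))%N. Proof. by lia. Qed.
Let le1 : (n <= k + (n - k))%N. Proof. by rewrite -eq_n. Qed.
Let le2 : (k + (n - k) <= n)%N. Proof. by rewrite -eq_n. Qed.

Definition skip_map z : 'I_n -> 'I_(k + (n - k)) := ord_map le1 (skip_perm k delta z).
Definition skip_inv z : 'I_(k + (n - k)) -> 'I_n := ord_map le2 (skip_perm_inv k delta z).
Definition swap_map : 'I_n -> 'I_(k + (n - k)) := ord_map le1 (swap_perm k (n - k)).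
Definition swap_inv : 'I_(k + (n - k)) -> 'I_n := ord_map le2 (swap_perm (n - k) k).

Lemma skip_invE z u : (z <= k)%N -> skip_inv z u = skip_perm_inv k delta z u :> nat.
Proof.
move=> le_zk; apply: val_ord_map; have := ltn_ord u.
by rewrite /skip_perm_inv; do ![case: ifP => ?]; lia.
Qed.

Lemma skip_mapE z j : (z <= k)%N -> skip_map z j = skip_perm k delta z j :> nat.
Proof.
move=> le_zk; apply: val_ord_map; have := ltn_ord j.
by rewrite /skip_perm; do ![case: ifP => ?]; lia.
Qed.

Lemma skip_invK z : (z <= k)%N -> cancel (skip_inv z) (skip_map z).
Proof.
move=> le_zk u; apply: val_inj; rewrite /= skip_mapE // skip_invE //.
have := ltn_ord u; rewrite /skip_perm_inv; do ![case: ifP => ?];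
  by rewrite /skip_perm; do ![case: ifP => ?]; lia.
Qed.

Lemma swap_mapE j : swap_map j = swap_perm k (n - k) j :> nat.
Proof.
by apply: val_ord_map; have := ltn_ord j; rewrite /swap_perm; case: ifP => ?; lia.
Qed.

Lemma swap_invE u : swap_inv u = swap_perm (n - k) k u :> nat.
Proof.
by apply: val_ord_map; have := ltn_ord u; rewrite /swap_perm; case: ifP => ?; lia.
Qed.

Lemma swap_invK : cancel swap_inv swap_map.
Proof.
move=> u; apply: val_inj; rewrite /= swap_mapE swap_invE.
have := ltn_ord u; rewrite {2}/swap_perm; case: ifP => ?;
  by rewrite /swap_perm; case: ifP => ?; lia.
Qed.

Lemma skip_map_id : skip_map k =1 cast_ord eq_n.
Proof.
move=> j; apply: val_inj; rewrite /= skip_mapE // /skip_perm.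
by do ![case: ifP => ?]; lia.
Qed.

Implicit Types A B : 'M[F]_(k, n - k).

Lemma lift_codeword A : lift_mx A = codeword (skip_map k) A.
Proof.
rewrite /lift_mx (conform_mx_colsub eq_n); congr rowspace; apply/matrixP => i j.
by rewrite !mxE skip_map_id.
Qed.

(* A vector w of the intersection that vanishes on the common pivots is, in B's
   basis, a combination of rows from z' on, hence vanishes on the first gap; so
   all its pivot coordinates for A are zero. *)
Lemma dim_cap_skip z z' A B : (z' + delta <= z <= k)%N ->
    (forall (r : 'I_k) (c : 'I_(n - k)), (c < delta)%N -> (z' <= r)%N -> B r c = 0) ->
  (\dim (codeword (skip_map z) A :&: codeword (skip_map z') B) <= k - delta)%N.
Proof.
move=> /andP[le_z'z le_zk] B0.
have le_s : (k - delta <= n)%N by lia.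
(* [s] lists the common pivots: the k - delta columns of [0, k + delta) outside both gaps. *)
pose s := ord_map le_s (fun t => if t < z' then t else
  if t < z - delta then (t + delta)%N else (t + 2 * delta)%N)%N.
have -> : (k - delta)%N = \dim {:'rV[F]_(k - delta)} by rewrite dimvf /dim /= mul1n.
apply: (@dim_le_inj_on _ _ _ (colproj F s)) => w; last by rewrite memvf.
rewrite memv_cap => /andP[/codewordP[x wA] /codewordP[y wB]] /rowP sw0.
have w0 (j : 'I_n) : (j < k + delta)%N -> ~~ (z' <= j < z' + delta)%N ->
    ~~ (z <= j < z + delta)%N -> w 0 j = 0.
  move=> ltj Z'j Zj.
  (* Inverts [s]: the index of column [j] drops by delta for each gap to its left. *)
  have [t tE] : {t | t = if j < z' then j : nat else if j < z then j - delta
    else j - 2 * delta}%N by eexists.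
  have lt_t : (t < k - delta)%N by move: tE; do ![case: ifP => ?]; lia.
  have -> : j = s (Ordinal lt_t); last by rewrite -colprojE sw0 mxE.
  apply: val_inj; rewrite /s val_ord_map /=; have := ltn_ord j; move: tE;
    by do ![case: ifP => ?]; lia.
have x_at r : w 0 (skip_inv z (lshift _ r)) = x 0 r by rewrite wA skip_invK ?row_mxEl.
have le_z'k : (z' <= k)%N by lia.
have y_at r : w 0 (skip_inv z' (lshift _ r)) = y 0 r by rewrite wB skip_invK ?row_mxEl.
have y0 (r : 'I_k) : (r < z')%N -> y 0 r = 0.
  move=> lt_rz'; rewrite -y_at; apply: w0; rewrite skip_invE // /skip_perm_inv /= ;
    have := ltn_ord r; by do ![case: ifP => ?]; lia.
have wZ' (j : 'I_n) : (z' <= j < z' + delta)%N -> w 0 j = 0.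
  move=> Z'j; have lt_c : (j - z' < n - k)%N by lia.
  have -> : j = skip_inv z' (rshift k (Ordinal lt_c)).
    by apply: val_inj; rewrite /= skip_invE // /skip_perm_inv /=; do ![case: ifP => ?]; lia.
  rewrite wB skip_invK // row_mxEr mxE big1 // => r _.
  case: (ltnP r z') => [/y0-> | le_z'r]; first by rewrite mul0r.
  by rewrite B0 ?mulr0 //=; lia.
have x0 : x = 0.
  apply/rowP => r; rewrite -x_at mxE; set j := skip_inv _ _.
  have jE : j = (if r < z then r : nat else r + delta)%N :> nat.
    by rewrite /j skip_invE // /skip_perm_inv /=; have := ltn_ord r; do ![case: ifP => ?]; lia.
  case: (boolP (z' <= j < z' + delta)%N) => [/wZ' // | nZ'j].
  by apply: w0 => //; move: jE; have := ltn_ord r; case: ifP => ?; lia.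
by apply/rowP => j; rewrite wA x0 mul0mx row_mx0 mxE [RHS]mxE.
Qed.

Lemma dim_cap_swap z A M : (z <= k)%N -> (2 * k + delta <= n)%N ->
  (\dim (codeword (skip_map z) A :&: codeword swap_map M) <= \rank M)%N.
Proof.
move=> le_zk le_2kdn; rewrite -dim_rowspace.
have le_s : (n - k <= n)%N by lia.
pose s := widen_ord le_s.
apply: (@dim_le_inj_on _ _ _ (colproj F s)) => w;
  rewrite memv_cap => /andP[/codewordP[x wA] /codewordP[y wM]].
  move=> /rowP sw0; have x0 : x = 0.
    apply/rowP => r; have <- : w 0 (skip_inv z (lshift _ r)) = x 0 r.
      by rewrite wA skip_invK ?row_mxEl.
    (* The pivots lie below k + delta, and k + delta <= n - k by the hypothesis on n. *)
    set j := skip_inv _ _; have lt_j : (j < n - k)%N.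
      by rewrite /j skip_invE // /skip_perm_inv /=; have := ltn_ord r; do ![case: ifP => ?]; lia.
    have -> : j = s (Ordinal lt_j) by apply: val_inj.
    by rewrite -colprojE sw0 !mxE.
  by apply/rowP => j; rewrite wA x0 mul0mx row_mx0 mxE [RHS]mxE.
apply/rowspaceP; exists y; apply/rowP => c; rewrite colprojE.
have -> : s c = swap_inv (rshift k c).
  by apply: val_inj; rewrite /= swap_invE /swap_perm /=; have := ltn_ord c; case: ifP => ?; lia.
by rewrite wM swap_invK row_mxEr.
Qed.

End Levels.

(** * Subcodes and padding of rank-metric codes *)

Section RankCodes.
Variables (F : finFieldType) (m p delta : nat).
Implicit Types D : {vspace 'M[F]_(m, p)}.

Lemma MRD_rank D A B : is_MRD delta D -> A \in D -> B \in D -> A != B ->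
  (delta <= \rank (A - B)%R)%N.
Proof.
move=> /andP[_ /forall_inP rkD] DA DB; rewrite -subr_eq0.
by have /implyP := rkD _ (memvB DA DB).
Qed.

Lemma dim_MRD D : (m <= p)%N -> is_MRD delta D -> \dim D = (p * (m - delta + 1))%N.
Proof.
by move=> le_mp /andP[/eqP-> _]; rewrite (maxn_idPr le_mp) (minn_idPl le_mp).
Qed.

Definition corner_subcode D z d : {set 'M[F]_(m, p)} :=
  [set A in D | [forall r : 'I_m, forall c : 'I_p,
     (z <= r)%N && (c < d)%N ==> (A r c == 0)]].

Lemma corner_subcodeP D z d A :
  reflect (A \in D /\ forall (r : 'I_m) (c : 'I_p), (z <= r)%N -> (c < d)%N -> A r c = 0)
          (A \in corner_subcode D z d).
Proof.
rewrite inE; apply: (iffP andP) => -[DA A0]; split=> //.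
  move=> r c le_zr lt_cd; apply/eqP.
  by move/forallP/(_ r)/forallP/(_ c)/implyP: A0; apply; apply/andP.
by apply/forallP => r; apply/forallP => c; apply/implyP => /andP[le_zr lt_cd]; rewrite A0.
Qed.

(** Rank-nullity for the linear map that reads off the corner block. *)
Lemma card_corner_subcode D z d : (z <= m)%N -> (d <= p)%N ->
  (#|F| ^ (\dim D - (m - z) * d) <= #|corner_subcode D z d|)%N.
Proof.
move=> le_zm le_dp.
pose rsel := ord_map (leq_subr z m) (addn z); pose csel := widen_ord le_dp.
pose f := linfun (mxsub rsel csel : 'M[F]_(m, p) -> 'M_(m - z, d)).
have dim_ker : (\dim D - (m - z) * d <= \dim (D :&: lker f))%N.
  rewrite -(limg_ker_dim f D) leq_subLR addnC leq_add2r.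
  by rewrite (leq_trans (dimvS (subvf _))) // dimvf dim_matrix.
apply: (@leq_trans #|(D :&: lker f)%VS|).
  by rewrite card_vspace leq_exp2l // finNzRing_gt1.
apply/subset_leq_card/subsetP => A; rewrite memv_cap memv_ker lfunE /=.
case/andP=> DA /eqP/matrixP fA0; apply/corner_subcodeP; split=> // r c le_zr lt_cd.
have lt_r : (r - z < m - z)%N by have := ltn_ord r; lia.
have := fA0 (Ordinal lt_r) (Ordinal lt_cd); rewrite !mxE.
congr (A _ _ = 0); apply: val_inj => //=.
by rewrite val_ord_map /=; have := ltn_ord r; lia.
Qed.

(** Right multiplication by this matrix prepends [d] zero columns. *)
Definition shift_mx d : 'M[F]_(p - d, p) := \matrix_(i, c) (c == (i + d)%N :> nat)%:R.

Lemma row_free_shift_mx d : (d <= p)%N -> row_free (shift_mx d).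
Proof.
move=> le_dp; apply/row_freeP; exists (shift_mx d)^T; apply/matrixP => i j.
have lt_i : (i + d < p)%N by have := ltn_ord i; lia.
rewrite !mxE (bigD1 (Ordinal lt_i)) //= !mxE eqxx mul1r big1 ?addr0 => [|c ne_c].
  by rewrite eqn_add2r.
by rewrite !mxE -val_eqE /= in ne_c *; rewrite (negPf ne_c) mul0r.
Qed.

Lemma mul_shift_mx_eq0 n d (B : 'M[F]_(n, p - d)) r (c : 'I_p) : (c < d)%N ->
  (B *m shift_mx d) r c = 0.
Proof.
move=> lt_cd; rewrite mxE big1 // => i _; rewrite mxE.
by case: eqP => [ce | _]; [lia | rewrite mulr0].
Qed.

End RankCodes.

Lemma AR_attained (F : finFieldType) m p delta K :
  exists2 D : {set 'M[F]_(m, p)}, is_restricted_rank_code delta K D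
    & #|D| = AR F m p delta K.
Proof.
have [|D PD ARE] := @eq_bigmax_cond _ (@is_restricted_rank_code F m p delta K) (fun D => #|D|).
  (* The empty code shows that the maximum is taken over a nonempty family. *)
  by apply/card_gt0P; exists set0; rewrite unfold_in;
    apply/andP; split; apply/forall_inP => A; rewrite inE.
by exists D; rewrite // /AR -ARE; apply: eq_bigl.
Qed.

Lemma Abar_ge (F : finFieldType) n delta k (C : {set {vspace 'rV[F]_n}}) :
  is_CDC (2 * delta) k C -> contains_lifted_MRD k delta C -> (#|C| <= Abar F n delta k)%N.
Proof.
by move=> CDC_C MRD_C; apply: leq_bigmax_cond; rewrite CDC_C.
Qed.

(** With t = x^-d the quotient is 1 + t + ... + t^(s-1). The bound on e keeps every difference e - i
    d exact in the natural numbers. *)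
Lemma geometric_sum (R : fieldType) (x : R) e d s : x != 0 -> x ^+ d != 1 ->
    ((s.-1) * d <= e)%N ->
  x ^+ e * ((1 - x ^- (s * d)) / (1 - x ^- d)) = \sum_(i < s) x ^+ (e - i * d).
Proof.
move=> x_n0 xd_n1 le_e; set t := x ^- d.
have t_n1 : 1 - t != 0 by rewrite subr_eq0 eq_sym invr_eq1.
have -> : x ^- (s * d) = t ^+ s by rewrite /t mulnC exprM exprVn.
have -> : 1 - t ^+ s = (1 - t) * \sum_(i < s) t ^+ i.
  by rewrite -opprB subrX1 -mulNr opprB.
rewrite [(1 - t) * _]mulrC mulfK // mulr_sumr; apply: eq_bigr => i _.
have le_ide : (i * d <= e)%N.
  by apply: leq_trans le_e; rewrite leq_mul2r; have := ltn_ord i; lia.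
by rewrite expfB_cond ?(negPf x_n0) // exprVn -exprM mulnC.
Qed.

(** * The layered code and its size *)

Section Construction.
Variables (F : finFieldType) (n k delta : nat).
Hypotheses (delta_gt0 : (0 < delta)%N) (hnk : (2 * k + delta <= n)%N)
  (hkd : (2 * delta <= k)%N).
Let s := (k %/ delta)%N.

Let le_kdn : (k + delta <= n)%N. Proof. by clear delta_gt0 hkd; lia. Qed.

Variables (D0 : {vspace 'M[F]_(k, n - k)}) (D1 : {vspace 'M[F]_(k, n - k - delta)})
  (DR : {set 'M[F]_(k, n - k)}).
Hypotheses (MRD_D0 : is_MRD delta D0) (MRD_D1 : is_MRD delta D1)
  (rank_DR : is_restricted_rank_code delta (nat_interval 0 (k - delta)) DR).

Definition layer_index : finType := ('I_s + bool)%type.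

(* inl a is the layer with gap at k - a delta, inr true the one with gap at 0,
   and inr false the layer of the (M | I). *)
Definition skip_pos (i : layer_index) : nat :=
  if i is inl a then (k - a * delta)%N else 0%N.

Definition layer_map (i : layer_index) : 'I_n -> 'I_(k + (n - k)) :=
  if i is inr false then swap_map le_kdn else skip_map le_kdn (skip_pos i).

Definition layer_inv (i : layer_index) : 'I_(k + (n - k)) -> 'I_n :=
  if i is inr false then swap_inv le_kdn else skip_inv le_kdn (skip_pos i).

Definition layer_mxs (i : layer_index) : {set 'M[F]_(k, n - k)} :=
  match i with
  | inl _ => corner_subcode D0 (skip_pos i) delta
  | inr true => [set B *m shift_mx F (n - k) delta | B in D1]
  | inr false => DR
  end.

Definition layered_code : {set {vspace 'rV[F]_n}} :=
  \bigcup_i [set codeword (layer_map i) A | A in layer_mxs i].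

Lemma skip_pos_le i : (skip_pos i <= k)%N.
Proof. by case: i => [a|] //=; apply: leq_subr. Qed.

Lemma layer_invK i : cancel (layer_inv i) (layer_map i).
Proof.
case: i => [a|[]]; last exact: swap_invK.
  by apply: skip_invK => //; apply: (skip_pos_le (inl a)).
exact: skip_invK.
Qed.

Lemma layer_mxs_corner i A : A \in layer_mxs i -> i != inr false ->
  forall (r : 'I_k) (c : 'I_(n - k)), (c < delta)%N -> (skip_pos i <= r)%N -> A r c = 0.
Proof.
case: i => [a|[]] //=.
  by move=> /corner_subcodeP[_ A0] _ r c lt_cd le_zr; apply: A0.
by move=> /imsetP[B _ ->] _ r c lt_cd _; apply: mul_shift_mx_eq0.
Qed.

Lemma layer_mxs_rank i : is_restricted_rank_code delta predT (layer_mxs i).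
Proof.
apply/andP; split; first by apply/forall_inP.
apply/forall_inP => A DA; apply/forall_inP => B DB; apply/implyP => neqAB.
case: i DA DB => [a|[]] /=.
- by move=> /corner_subcodeP[DA _] /corner_subcodeP[DB _]; apply: (MRD_rank MRD_D0).
- move=> /imsetP[A' DA' defA] /imsetP[B' DB' defB]; rewrite /rank_dist defA defB -mulmxBl.
  rewrite mxrankMfree ?row_free_shift_mx //; last by lia.
  by apply: (MRD_rank MRD_D1) => //; apply: contraNneq neqAB => eqAB; rewrite defA defB eqAB.
move=> DA DB; have /andP[_ /forall_inP/(_ _ DA)/forall_inP/(_ _ DB)] := rank_DR.
by rewrite neqAB.
Qed.

(** The gaps at k - a delta are spaced by delta, and (a + 1) delta <= k for a < k / delta keeps them
    clear of [0, delta), the gap of [inr true]. *)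
Lemma skip_pos_gap (i j : layer_index) : i != j -> i != inr false -> j != inr false ->
  (skip_pos i + delta <= skip_pos j)%N || (skip_pos j + delta <= skip_pos i)%N.
Proof.
have lt_s (a : 'I_s) : (a * delta + delta <= k)%N.
  by rewrite -mulSnr (leq_trans _ (leq_trunc_div k delta)) // leq_mul2r ltn_ord orbT.
case: i j => [a|[]] [b|[]] //= neq _ _; last 2 first.
- by have := lt_s a; lia.
- by have := lt_s b; lia.
have := lt_s a; have := lt_s b; have : val a != val b by apply: contraNneq neq => /val_inj->.
rewrite neq_ltn => /orP[] lt_ab.
  by have := leq_mul lt_ab (leqnn delta); rewrite mulSn /=; lia.
by have := leq_mul lt_ab (leqnn delta); rewrite mulSn /=; lia.
Qed.

Lemma dim_cap_layers i j A B : i != j -> A \in layer_mxs i -> B \in layer_mxs j ->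
  (\dim (codeword (layer_map i) A :&: codeword (layer_map j) B) <= k - delta)%N.
Proof.
have cap_swap i0 A0 B0 : i0 != inr false -> B0 \in DR ->
    (\dim (codeword (layer_map i0) A0 :&: codeword (layer_map (inr false)) B0) <= k - delta)%N.
  move=> neq DB; have -> : layer_map i0 = skip_map le_kdn (skip_pos i0).
    by case: (i0) neq => [a|[]].
  apply: leq_trans (dim_cap_swap le_kdn _ _ (skip_pos_le i0) hnk) _.
  by have /andP[/forall_inP/(_ _ DB)] := rank_DR.
move=> neqij DA DB.
have [i_swap|i_skip] := eqVneq i (inr false).
  by rewrite capvC; subst i; apply: cap_swap => //; rewrite eq_sym.
have [j_swap|j_skip] := eqVneq j (inr false).
  by subst j; apply: cap_swap.
have layer_skip i0 : i0 != inr false -> layer_map i0 = skip_map le_kdn (skip_pos i0).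
  by case: i0 => [a|[]].
(* [dim_cap_skip] wants the layer with the larger gap position first, hence the swap in one case. *)
rewrite !layer_skip //; case/orP: (skip_pos_gap neqij i_skip j_skip) => gap.
  rewrite capvC; apply: dim_cap_skip => //; first by rewrite gap skip_pos_le.
  exact: layer_mxs_corner.
apply: dim_cap_skip => //; first by rewrite gap skip_pos_le.
exact: layer_mxs_corner.
Qed.

Lemma layered_code_CDC : is_CDC (2 * delta) k layered_code /\
  #|layered_code| = \sum_i #|layer_mxs i|.
Proof.
apply: code_union layer_invK layer_mxs_rank dim_cap_layers.
by rewrite delta_gt0; lia.
Qed.

Lemma layered_code_lifted_MRD : contains_lifted_MRD k delta layered_code.
Proof.
apply/existsP; exists D0; rewrite MRD_D0; apply/subsetP => _ /imsetP[A DA ->].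
have s_gt0 : (0 < s)%N by rewrite divn_gt0 //; lia.
apply/bigcupP; exists (inl (Ordinal s_gt0)) => //; apply/imsetP; exists A.
  (* With the gap at k the corner has no rows, so this layer uses all of [D0]. *)
  by apply/corner_subcodeP; split=> // r c; rewrite /= mul0n subn0 leqNgt ltn_ord.
by rewrite (lift_codeword le_kdn) /= mul0n subn0.
Qed.

Lemma card_layered_code :
  (\sum_(i < s) #|F| ^ ((n - k) * (k - delta + 1) - i * delta ^ 2)
     + #|F| ^ ((n - k - delta) * (k - delta + 1)) + #|DR| <= #|layered_code|)%N.
Proof.
rewrite layered_code_CDC.2 big_sumType big_bool /= -addnA leq_add //.
  apply: leq_sum => i _; have [le1 le2] : (delta <= n - k)%N /\ (i * delta <= k)%N.
    split; first by lia.
    by rewrite (leq_trans _ (leq_trunc_div k delta)) // leq_mul2r ltnW ?orbT.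
  apply: leq_trans (card_corner_subcode _ (leq_subr _ _) le1).
  (* The corner has k - (k - i delta) = i delta rows, hence i delta^2 equations. *)
  rewrite subKn // -mulnA (dim_MRD _ MRD_D0) //; lia.
(* Padding with zero columns is injective, so this layer is as large as [D1]. *)
rewrite leq_add2r card_in_imset.
  by rewrite card_vspace (dim_MRD _ MRD_D1) //; lia.
have le_d : (delta <= n - k)%N by lia.
by move=> A B _ _ /(row_free_inj (row_free_shift_mx F le_d)).
Qed.

End Construction.

Theorem theorem3p12 (q : nat) (F : finFieldType) (hq : #|F| = q)
    (n k delta : nat)
    (hn : (0 < n)%N) (hk : (0 < k)%N) (hdelta : (0 < delta)%N)
    (hnk : (2 * k + delta <= n)%N) (hkd : (2 * delta <= k)%N) :
  (q%:R ^+ ((n - k) * (k - delta + 1))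
     * ((1 - q%:R ^- (k %/ delta * delta ^ 2)) / (1 - q%:R ^- (delta ^ 2)))
   + q%:R ^+ ((n - k - delta) * (k - delta + 1))
   + (AR F k (n - k) delta (nat_interval 0 (k - delta)))%:R : rat)
  <= (Abar F n delta k)%:R.
Proof.
have range_delta : (0 < delta <= k)%N by lia.
have [D0 MRD_D0] : {D : {vspace 'M[F]_(k, n - k)} | is_MRD delta D}.
  by apply: exists_MRD => //; lia.
(* k <= n - k - delta, so the shorter matrices still have at least as many columns as rows. *)
have [D1 MRD_D1] : {D : {vspace 'M[F]_(k, n - k - delta)} | is_MRD delta D}.
  by apply: exists_MRD => //; lia.
have [DR rank_DR <-] := AR_attained F k (n - k) delta (nat_interval 0 (k - delta)).
pose C := layered_code hnk D0 D1 DR.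
have [CDC_C _] := layered_code_CDC hdelta hnk hkd MRD_D0 MRD_D1 rank_DR.
have MRD_C : contains_lifted_MRD k delta C by apply: layered_code_lifted_MRD.
have := leq_trans (card_layered_code hdelta hnk hkd MRD_D0 MRD_D1 rank_DR)
  (Abar_ge CDC_C MRD_C).
have q_gt1 : (1 < q)%N by rewrite -hq finNzRing_gt1.
(* Term i of the expanded sum is the lower bound for the layer with gap at k - i delta. *)
rewrite geometric_sum.
- rewrite -(ler_nat rat) !natrD natr_sum hq natrX => le_C; apply: le_trans le_C.
  by under [in X in _ <= X]eq_bigr do rewrite natrX.
- by rewrite pnatr_eq0; lia.
- by rewrite -natrX pnatr_eq1 -[1%N](expn0 q) eqn_exp2l // expn_eq0; lia.
have le_sd : (k %/ delta * delta <= k)%N := leq_trunc_div k delta.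
(* The product is regrouped to be bounded factor by factor: (k / delta - 1) delta <= k <= n - k and
   delta <= k - delta + 1. *)
have -> : ((k %/ delta).-1 * delta ^ 2 = ((k %/ delta).-1 * delta) * delta)%N.
  by rewrite -mulnA.
apply: leq_mul; last by lia.
by apply: (@leq_trans (k %/ delta * delta)); [rewrite leq_mul2r leq_pred orbT | lia].
Qed.
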